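(* Let $\partial\in\mathbb{Z}^{n\times n}$ satisfy $\partial^t=\partial$ or $\partial^t=-\partial$. Then $$\operatorname{pdet}(\partial\partial^t)=\operatorname{pdet}(\partial)^2.$$ More generally, with indeterminates $\mathbf{x}=(x_1,\dots,x_n)$, $\mathbf{y}=(y_1,\dots,y_n)$, $X=\operatorname{diag}(\mathbf{x})$, $Y=\operatorname{diag}(\mathbf{y})$, the matrix $L:=X^{1/2}\partial Y\partial^tX^{1/2}$ satisfies $$\operatorname{pdet}(L)=\operatorname{pdet}(X\partial)\,\operatorname{pdet}(Y\partial^t).$$
   Context: For a square matrix $M$ of size $n$ over an integral domain (here e.g. $\mathbb{Z}[x_1^{1/2},\dots,x_n^{1/2},y_1,\dots,y_n]$), of rank $s$ over the fraction field, $\operatorname{pdet}(M):=\sum_{I\subseteq\{1,\dots,n\},|I|=s}\det(M_{I,I})$, where $M_{I,I}$ is the principal submatrix with rows and columns indexed by $I$. *)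

(* Defs.v *)
From HB Require Import structures.
From mathcomp Require Export all_boot all_order all_algebra.
From mathcomp Require Export fraction.
From mathcomp.multinomials Require Export mpoly.

Set Implicit Arguments.
Unset Strict Implicit.
Unset Printing Implicit Defensive.

Import GRing.Theory.
Local Open Scope ring_scope.

Definition frac_rank (R : idomainType) (m n : nat) (M : 'M[R]_(m, n)) : nat :=
  \rank (map_mx (@tofrac R) M).

(* [enum_val] lists the elements of [I] in increasing order. *)
Definition principal_submx (R : Type) (n : nat) (M : 'M[R]_n) (I : {set 'I_n}) :
    'M[R]_#|I| :=
  mxsub (fun k => enum_val k) (fun k => enum_val k) M.

Definition pdet (R : idomainType) (n : nat) (M : 'M[R]_n) : R :=
  \sum_(I : {set 'I_n} | #|I| == frac_rank M) \det (principal_submx M I).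

(* The ring Z[x_1^(1/2), ..., x_n^(1/2), y_1, ..., y_n]: of its 2n
   indeterminates, the first n are the square roots x_i^(1/2) and the last n
   are the y_i, so that x_i itself is the square of the i-th indeterminate. *)
Definition xyring (n : nat) : idomainType := {mpoly int[n + n]}.

Definition sqrtx (n : nat) (i : 'I_n) : xyring n := 'X_(lshift n i).
Definition yvar (n : nat) (i : 'I_n) : xyring n := 'X_(rshift n i).

Definition diagXhalf (n : nat) : 'M[xyring n]_n := diag_mx (\row_i sqrtx i).
Definition diagX (n : nat) : 'M[xyring n]_n := diag_mx (\row_i (sqrtx i ^+ 2)).
Definition diagY (n : nat) : 'M[xyring n]_n := diag_mx (\row_i yvar i).

Definition xymx (n : nat) (A : 'M[int]_n) : 'M[xyring n]_n :=
  map_mx (intr : int -> xyring n) A.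

Definition Lmx (n : nat) (d : 'M[int]_n) : 'M[xyring n]_n :=
  diagXhalf n *m xymx d *m diagY n *m xymx d^T *m diagXhalf n.

(* Main.v *)
(* Let [s] be the rank of the matrix [M]. The minors of order [s] form a matrix
   of rank one, so [det M_{I,J} det M_{J,I} = det M_{I,I} det M_{J,J}]; for
   [M^T = M] or [M^T = - M] this gives
   [det M_{I,J} ^ 2 = det M_{I,I} det M_{J,J}].
   By Cauchy-Binet, [pdet L] is the sum of [x_I y_J det M_{I,J} ^ 2], which
   therefore factors as the product of the two sums. That all matrices involved
   have rank [s] is seen by specializing every indeterminate to [1]: over the
   integers [d d^T] has the rank of [d] because a sum of squares of minors
   vanishes only if each of them does. *)
Require Import Defs.
From mathcomp Require Import all_fingroup.
Set Implicit Arguments.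
Unset Strict Implicit.
Unset Printing Implicit Defensive.

Import Order.TTheory GRing.Theory Num.Theory.
Local Open Scope ring_scope.

(** * Determinants of submatrices and Cauchy-Binet *)

Lemma det_mxsub_perm (R : comNzRingType) (m : nat) (s : 'S_m) (A : 'M[R]_m) :
  \det (mxsub s s A) = \det A.
Proof.
have -> : mxsub s s A = row_perm s (col_perm s A).
  by apply/matrixP => i j; rewrite !mxE.
rewrite row_permE col_permE !det_mulmx !det_perm odd_permV mulrCA -signr_addb.
by rewrite addbb expr0 mulr1.
Qed.

Lemma det_mxsub_noninj (R : comNzRingType) (m n : nat) (A : 'M[R]_n)
    (f g : 'I_m -> 'I_n) :
  ~~ injectiveb f -> \det (mxsub f g A) = 0.
Proof.
case/injectivePn => i1 [i2 Di12 Ef12].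
by rewrite (determinant_alternate Di12) // => j; rewrite !mxE Ef12.
Qed.

(** [f] enumerates [I] up to a permutation, which acts on rows and columns alike, so that its sign
    cancels. *)
Lemma det_mxsub_principal (R : comNzRingType) (n : nat) (M : 'M[R]_n)
    (I : {set 'I_n}) (f : 'I_#|I| -> 'I_n) :
  injective f -> (forall k, f k \in I) ->
  \det (mxsub f f M) = \det (principal_submx M I).
Proof.
move=> injf fI; pose h k := enum_rank_in (fI k) (f k).
have hK k : enum_val (h k) = f k by rewrite enum_rankK_in.
have injh : injective h by move=> i j eqh; apply: injf; rewrite -!hK eqh.
rewrite -[RHS](det_mxsub_perm (perm injh)); congr (\det _).
by apply/matrixP => i j; rewrite !mxE !permE !hK.
Qed.

(* Every [I] of size [s] is the image of exactly [s`!] injections, and maps that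
   are not injective contribute [0]; indexing by maps avoids any bookkeeping of
   increasing enumerations below. *)
Lemma sum_det_principal (R : comNzRingType) (n s : nat) (M : 'M[R]_n) :
  \sum_(f : {ffun 'I_s -> 'I_n}) \det (mxsub f f M) =
  (\sum_(I : {set 'I_n} | #|I| == s) \det (principal_submx M I)) *+ s`!.
Proof.
rewrite (bigID (fun f : {ffun 'I_s -> 'I_n} => injectiveb f)) /= addrC.
rewrite big1 ?add0r => [|f]; last exact: det_mxsub_noninj.
rewrite (partition_big (fun f : {ffun 'I_s -> 'I_n} => f @: 'I_s)
           (fun I => #|I| == s)) /=; last first.
  by move=> f /injectiveP injf; rewrite card_imset // card_ord.
rewrite -sumrMnl; apply: eq_bigr => I /eqP sI; subst s.
rewrite (eq_bigl (mem [set f : {ffun 'I_#|I| -> 'I_n} in ffun_on (mem I)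
                      | injectiveb f])); last first.
  move=> f; rewrite !inE andbC; case: injectiveP => [injf|_]; rewrite ?andbF //.
  rewrite !andbT eqEcard card_imset // card_ord leqnn andbT.
  apply/subsetP/ffun_onP => [sub k|sub _ /imsetP[k _ ->]]; last exact: sub.
  by apply: sub; apply: imset_f.
rewrite (eq_bigr (fun=> \det (principal_submx M I))); last first.
  move=> f; rewrite !inE => /andP[/ffun_onP fI /injectiveP injf].
  exact: det_mxsub_principal.
by rewrite sumr_const card_inj_ffuns_on card_ord ffactnn.
Qed.

(* Cauchy-Binet, with the intermediate minors indexed by maps. *)
Lemma det_mul_sum (R : comNzRingType) (m n : nat)
    (A : 'M[R]_(m, n)) (B : 'M[R]_(n, m)) :
  \det (A *m B) *+ m`! =
  \sum_(g : {ffun 'I_m -> 'I_n}) \det (colsub g A) * \det (rowsub g B).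
Proof.
have detE : \det (A *m B) =
    \sum_(g : {ffun 'I_m -> 'I_n}) (\prod_i A i (g i)) * \det (rowsub g B).
  pose AB (s : 'S_m) i j := A i j * B j (s i).
  transitivity (\sum_(g : {ffun 'I_m -> 'I_n})
      \sum_(s : 'S_m) (-1) ^+ s * \prod_i AB s i (g i)).
    rewrite exchange_big; apply: eq_bigr => /= s _; rewrite -big_distrr /=.
    congr (_ * _); rewrite -(bigA_distr_bigA (AB s)) /=.
    by apply: eq_bigr => x _; rewrite mxE.
  apply: eq_bigr => g _; rewrite big_distrr /=; apply: eq_bigr => s _.
  rewrite mulrCA big_split //=; congr (_ * (_ * _)).
  by apply: eq_bigr => x _; rewrite mxE.
(* For each fixed permutation [s], the sum over [g] is one copy of [\det (A *m B)]: precomposing [g]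
   with [s] in [detE] permutes the rows of [rowsub g B] and yields the sign of [s]. *)
transitivity (\sum_(g : {ffun 'I_m -> 'I_n}) \sum_(s : 'S_m)
    (-1) ^+ s * (\prod_i A i (g (s i))) * \det (rowsub g B)); last first.
  apply: eq_bigr => g _; rewrite big_distrl; apply: eq_bigr => s _.
  by congr (_ * _ * _); apply: eq_bigr => i _; rewrite mxE.
rewrite exchange_big /= -card_Sn -sumr_const.
apply: eq_big => [s|s _]; first by rewrite inE.
rewrite detE; pose act (t : 'S_m) (g : {ffun 'I_m -> 'I_n}) := [ffun i => g (t i)].
rewrite [LHS](reindex (act s)); last first.
  by exists (act s^-1%g) => g _; apply/ffunP => i; rewrite !ffunE (permK, permKV).
apply: eq_bigr => g _.
have -> : rowsub (act s g) B = row_perm s (rowsub g B).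
  by apply/matrixP => i j; rewrite !mxE ffunE.
rewrite row_permE det_mulmx det_perm mulrA [_ * (-1) ^+ _]mulrC.
by congr (_ * _ * _); apply: eq_bigr => i _; rewrite ffunE.
Qed.

(** * Rank and minors over the fraction field *)

Lemma tofrac_det (R : idomainType) (m : nat) (A : 'M[R]_m) :
  \det (map_mx (@tofrac R) A) = tofrac (\det A).
Proof. exact: det_map_mx. Qed.

(** Take a row basis and, within these rows, a column basis. With [minor_frac_rank] this expresses
    the rank by minors over [R] itself, which ring morphisms respect. *)
Lemma frac_rank_minor (R : idomainType) (m n : nat) (M : 'M[R]_(m, n)) :
  exists (f : 'I_(frac_rank M) -> 'I_m) (g : 'I_(frac_rank M) -> 'I_n),
    \det (mxsub f g M) != 0.
Proof.
rewrite /frac_rank; set A := map_mx _ M; pose f := maxrankfun A.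
have full : row_full (rowsub f A)^T.
  by rewrite -col_leq_rank mxrank_tr row_leq_rank maxrowsub_free.
exists f, (fullrankfun full); rewrite -tofrac_eq0 -tofrac_det map_mxsub.
have := fullrowsub_unit full; rewrite unitmxE unitfE -det_tr.
by congr (\det _ != 0); apply/matrixP => i j; rewrite !mxE.
Qed.

Lemma minor_frac_rank (R : idomainType) (m n s : nat) (M : 'M[R]_(m, n))
    (f : 'I_s -> 'I_m) (g : 'I_s -> 'I_n) :
  \det (mxsub f g M) != 0 -> (s <= frac_rank M)%N.
Proof.
rewrite -tofrac_eq0 -tofrac_det map_mxsub -unitfE -unitmxE => /mxrank_unit {1}<-.
rewrite -[map_mx _ M]mulmx1 mxsub_mul rowsubE.
apply: leq_trans (mxrankM_maxl _ _) _; exact: mxrankM_maxr.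
Qed.

Lemma frac_rank_tr (R : idomainType) (m n : nat) (M : 'M[R]_(m, n)) : frac_rank M^T = frac_rank M.
Proof. by rewrite /frac_rank -map_trmx mxrank_tr. Qed.

Lemma frac_rankM_maxl (R : idomainType) (m n p : nat) (A : 'M[R]_(m, n)) (B : 'M[R]_(n, p)) :
  (frac_rank (A *m B) <= frac_rank A)%N.
Proof. by rewrite /frac_rank map_mxM mxrankM_maxl. Qed.

Lemma frac_rankM_maxr (R : idomainType) (m n p : nat) (A : 'M[R]_(m, n)) (B : 'M[R]_(n, p)) :
  (frac_rank (A *m B) <= frac_rank B)%N.
Proof. by rewrite /frac_rank map_mxM mxrankM_maxr. Qed.

(* The compound matrix of order [frac_rank M] has rank one. *)
Lemma minor_exchange (R : idomainType) (n : nat) (M : 'M[R]_n) (f g : 'I_(frac_rank M) -> 'I_n) :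
  \det (mxsub f g M) * \det (mxsub g f M) =
  \det (mxsub f f M) * \det (mxsub g g M).
Proof.
apply/eqP; rewrite -tofrac_eq !rmorphM /= -!tofrac_det !map_mxsub.
(* A full-rank factorization has inner dimension equal to the order of the minors, so each minor
   splits into a factor depending on its rows and one depending on its columns. *)
rewrite -[map_mx _ M]mulmx_base !mxsub_mul !det_mulmx.
by apply/eqP; rewrite mulrACA [in RHS]mulrACA; congr (_ * _); exact: mulrC.
Qed.

(** A minor with nonzero image is itself nonzero. *)
Lemma frac_rank_map (R S : idomainType) (phi : {rmorphism R -> S}) (m n : nat)
    (M : 'M[R]_(m, n)) :
  (frac_rank (map_mx phi M) <= frac_rank M)%N.
Proof.
have [f [g]] := frac_rank_minor (map_mx phi M).
rewrite -map_mxsub det_map_mx => nz; apply: (@minor_frac_rank _ _ _ _ _ f g).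
by apply: contraNneq nz => ->; rewrite rmorph0.
Qed.

(** * Minors and pseudodeterminants of weighted products *)

Lemma det_mxsub_mul_diag (R : comNzRingType) (m n : nat) (u : 'I_n -> R)
    (M : 'M[R]_n) (f g : 'I_m -> 'I_n) :
  \det (mxsub f g (diag_mx (\row_i u i) *m M)) =
  (\prod_i u (f i)) * \det (mxsub f g M).
Proof.
have -> : mxsub f g (diag_mx (\row_i u i) *m M) =
    diag_mx (\row_i u (f i)) *m mxsub f g M.
  by apply/matrixP => i j; rewrite !mul_diag_mx !mxE.
by rewrite det_mulmx det_diag; congr (_ * _); apply: eq_bigr => i _; rewrite mxE.
Qed.

Lemma det_mxsub_tr (R : comNzRingType) (m n : nat) (M : 'M[R]_n)
    (f g : 'I_m -> 'I_n) :
  \det (mxsub f g M^T) = \det (mxsub g f M).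
Proof. by rewrite -det_tr; congr (\det _); apply/matrixP => i j; rewrite !mxE. Qed.

Lemma det_mxsub_weighted_gram (R : comNzRingType) (n s : nat) (M : 'M[R]_n)
    (u v : 'I_n -> R) (f : 'I_s -> 'I_n) :
  \det (mxsub f f (diag_mx (\row_i u i) *m M *m diag_mx (\row_i v i) *m M^T
                   *m diag_mx (\row_i u i))) *+ s`! =
  \sum_(g : {ffun 'I_s -> 'I_n})
    (\prod_i u (f i) ^+ 2) * (\prod_i v (g i)) * \det (mxsub f g M) ^+ 2.
Proof.
(* Cauchy-Binet is applied with the product cut just before the [v] diagonal; each half then
   contributes one factor [u (f i)]. *)
rewrite -!mulmxA [X in mxsub _ _ X]mulmxA mxsub_mul det_mul_sum.
apply: eq_bigr => g _; rewrite -mxsubrc -mxsubcr.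
have -> : \det (mxsub f g (diag_mx (\row_i u i) *m M)) =
   (\prod_i u (f i)) * \det (mxsub f g M) by exact: det_mxsub_mul_diag.
have -> : \det (mxsub g f (diag_mx (\row_i v i) *m (M^T *m diag_mx (\row_i u i))))
   = (\prod_i v (g i)) * ((\prod_i u (f i)) * \det (mxsub f g M)).
  rewrite det_mxsub_mul_diag -det_mxsub_tr trmx_mul tr_diag_mx trmxK.
  by rewrite det_mxsub_mul_diag.
by rewrite prodrXl mulrCA -expr2 exprMn mulrCA mulrA.
Qed.

(* In the skew case with odd [s] the principal minors vanish, and then so do
   all minors of order [s]; hence the parity of the rank is never needed. *)
Lemma sqr_minor (R : idomainType) (n : nat) (M : 'M[R]_n)
    (char0 : forall k, k.+1%:R != 0 :> R) (hM : M^T = M \/ M^T = - M)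
    (f g : 'I_(frac_rank M) -> 'I_n) :
  \det (mxsub f g M) ^+ 2 = \det (mxsub f f M) * \det (mxsub g g M).
Proof.
rewrite -minor_exchange expr2 -[\det (mxsub g f M)]det_mxsub_tr.
case: hM => hM; first by rewrite hM.
have detN (f' g' : 'I_(frac_rank M) -> 'I_n) : \det (mxsub f' g' M^T) =
    (-1) ^+ frac_rank M * \det (mxsub f' g' M).
  rewrite hM -detZ; congr (\det _).
  by apply/matrixP => i j; rewrite !mxE mulN1r.
have [odd_s|even_s] := boolP (odd (frac_rank M)); last first.
  by rewrite detN -signr_odd (negbTE even_s) mul1r.
suff /eqP : \det (mxsub f g M) * \det (mxsub f g M^T) = 0.
  rewrite detN -signr_odd odd_s expr1 mulN1r mulrN oppr_eq0 => /eqP ->.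
  by rewrite oppr0.
rewrite det_mxsub_tr minor_exchange.
suff -> : \det (mxsub f f M) = 0 by rewrite mul0r.
(* A principal minor of odd order equals its own negative, and 2 is nonzero by [char0]. *)
apply/eqP; have := detN f f; rewrite det_mxsub_tr -signr_odd odd_s expr1 mulN1r.
move/eqP; rewrite -addr_eq0 -mulr2n -mulr_natl mulf_eq0.
by rewrite (negbTE (char0 1%N)).
Qed.

(** Both claims are instances: weights 1 over the integers, and indeterminates as weights. *)
Lemma pdet_weighted_gram (R : idomainType) (n : nat) (M : 'M[R]_n)
    (u v : 'I_n -> R) (U := diag_mx (\row_i u i)) (V := diag_mx (\row_i v i))
    (U2 := diag_mx (\row_i u i ^+ 2)) :
  (forall k, k.+1%:R != 0 :> R) -> M^T = M \/ M^T = - M ->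
  frac_rank (U *m M *m V *m M^T *m U) = frac_rank M ->
  frac_rank (U2 *m M) = frac_rank M ->
  frac_rank (V *m M^T) = frac_rank M ->
  pdet (U *m M *m V *m M^T *m U) = pdet (U2 *m M) * pdet (V *m M^T).
Proof.
move=> char0 hM rL rUM rVM; rewrite /pdet rL rUM rVM.
set s := frac_rank M.
have sn0 : s`!%:R != 0 :> R by case: (s`!) (fact_gt0 s) => // k _; exact: char0.
(* On the left, one factorial pays for summing over maps [f] and one for Cauchy-Binet; on the right,
   each [pdet] absorbs one. *)
apply: (mulIf sn0); apply: (mulIf sn0).
rewrite -[RHS]mulrA mulrACA !mulr_natr -!sum_det_principal -sumrMnl.
rewrite big_distrl /=; apply: eq_bigr => f _.
rewrite det_mxsub_weighted_gram big_distrr /=; apply: eq_bigr => g _.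
rewrite !det_mxsub_mul_diag det_mxsub_tr sqr_minor //.
by rewrite mulrACA.
Qed.

Lemma frac_rank_gram (n : nat) (d : 'M[int]_n) :
  frac_rank (d *m d^T) = frac_rank d.
Proof.
apply/eqP; rewrite eqn_leq frac_rankM_maxl /=.
have [f [g nz]] := frac_rank_minor d.
apply: (@minor_frac_rank _ _ _ _ _ f f).
have : \det (mxsub f f (d *m d^T)) *+ (frac_rank d)`! != 0.
  rewrite mxsub_mul det_mul_sum.
  rewrite (eq_bigr (fun h : {ffun _ -> _} => \det (mxsub f h d) ^+ 2)); last first.
    by move=> h _; rewrite -mxsubrc -mxsubcr det_mxsub_tr expr2.
  (* The square indexed by the chosen [g] is positive, the others are nonnegative. *)
  rewrite gt_eqF // (bigD1 (finfun g)) //= ltr_pwDl ?sumr_ge0 //.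
    rewrite lt0r sqr_ge0 andbT expf_neq0 //.
    by rewrite mxsub_ffunr.
  by move=> h _; rewrite sqr_ge0.
by apply: contraNneq => ->; rewrite mul0rn.
Qed.

Theorem theorem4p3 (n : nat) (d : 'M[int]_n) (hd : d^T = d \/ d^T = - d) :
  pdet (d *m d^T) = pdet d ^+ 2 /\
  pdet (Lmx d) = pdet (diagX n *m xymx d) * pdet (diagY n *m xymx d^T).
Proof.
split.
  have char0 k : k.+1%:R != 0 :> int by rewrite pnatr_eq0.
  have diag1 : diag_mx (\row_(i < n) (1 : int)) = 1%:M.
    by apply/matrixP => i j; rewrite !mxE.
  have := @pdet_weighted_gram _ n d (fun=> 1) (fun=> 1) char0 hd.
  rewrite /= diag1 !mul1mx !mulmx1 frac_rank_tr frac_rank_gram => -> //.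
  rewrite expr2; congr (_ * _); rewrite /pdet frac_rank_tr.
  by apply: eq_bigr => I _; rewrite det_mxsub_tr.
pose ev : {rmorphism xyring n -> int} := meval (fun=> 1).
have evX i : ev ('X_i) = 1 by exact: mevalXU.
have evd A : map_mx ev (xymx A) = A.
  by apply/matrixP => i j; rewrite !mxE rmorph_int intz.
have evh : map_mx ev (diagXhalf n) = 1%:M.
  by apply/matrixP => i j; rewrite !mxE rmorphMn evX.
have evY : map_mx ev (diagY n) = 1%:M.
  by apply/matrixP => i j; rewrite !mxE rmorphMn evX.
have evX2 : map_mx ev (diagX n) = 1%:M.
  by apply/matrixP => i j; rewrite !mxE rmorphMn rmorphXn evX expr1n.
have char0 k : k.+1%:R != 0 :> xyring n.
  apply/eqP => /(congr1 ev); rewrite rmorph_nat rmorph0 => /eqP.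
  by rewrite pnatr_eq0.
(* Each matrix is the image of the other, under the inclusion of constants and under [ev]. *)
have rd : frac_rank (xymx d) = frac_rank d.
  apply/eqP; rewrite eqn_leq frac_rank_map /= -{1}(evd d); exact: frac_rank_map.
rewrite /Lmx /xymx -!map_trmx.
apply: pdet_weighted_gram char0 _ _ _ _.
- by rewrite map_trmx; case: hd => ->; [left|right; rewrite map_mxN].
- apply/eqP; rewrite eqn_leq; apply/andP; split.
    do 3!apply: leq_trans (frac_rankM_maxl _ _) _.
    exact: frac_rankM_maxr.
  rewrite rd -frac_rank_gram; apply: leq_trans (frac_rank_map ev _).
  by rewrite !map_mxM /= evh evY map_trmx !evd !mul1mx !mulmx1.
- apply/eqP; rewrite eqn_leq frac_rankM_maxr rd.
  apply: leq_trans (frac_rank_map ev _).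
  by rewrite !map_mxM /= evX2 evd mul1mx.
apply/eqP; rewrite eqn_leq -[X in (_ <= X)%N && _]frac_rank_tr frac_rankM_maxr rd.
apply: leq_trans (frac_rank_map ev _).
by rewrite !map_mxM /= evY map_trmx evd mul1mx frac_rank_tr.
Qed.
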